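(* Let $W = T \rtimes W_0$ be an affine Coxeter group with translation subgroup $T$ and finite part $W_0$. Let $w \in W$ be an arbitrary element with translation elliptic factorisation $w = tu$. Then for every finite generating set $S$ of $W$, the growth function of the conjugacy class $C(w) = \{hwh^{-1} : h \in W\}$ satisfies $$\beta_{C(w),S}(n) \sim n^{\ell_R(u)},$$ where $\ell_R(u)$ is the reflection length of $u$.
   Context: Affine Coxeter groups: let $V$ be a finite-dimensional Euclidean vector space with inner product $\langle\cdot,\cdot\rangle$, identified with the underlying Euclidean affine space $E$ by a choice of origin, and let $\Phi \subset V$ be a finite crystallographic root system with $\mathrm{span}(\Phi) = V$. For $\alpha \in \Phi$ and $j \in \mathbb{Z}$ let $H_{\alpha,j} = \{\lambda \in V : \langle \lambda,\alpha\rangle = j\}$ and let $r_{\alpha,j}$ be the orthogonal reflection fixing $H_{\alpha,j}$ pointwise. The affine Coxeter group $W$ is the group of isometries generated by $R = \{r_{\alpha,j} : \alpha \in \Phi, j \in \mathbb{Z}\}$, which is the set of reflections of $W$. Its finite part $W_0$ is the finite subgroup generated by $\{r_{\alpha,0} : \alpha \in \Phi\}$. The map $r_{\alpha,j} \mapsto r_{\alpha,0}$ extends to a group homomorphism $\pi \colon W \to W_0$ whose kernel $T$ is the subgroup of all translations in $W$; $T$ is a normal free abelian subgroup of finite index and $W = T \rtimes W_0$. The reflection length $\ell_R(w)$ of $w \in W$ is the smallest integer $k \ge 0$ such that $w = r_1\cdots r_k$ with all $r_i \in R$. An element of $W$ is elliptic if it fixes some point of $E$ (in particular every element of $W_0$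 is elliptic). A translation elliptic factorisation of $w \in W$ is an expression $w = tu$ with $t \in T$ and $u \in W$ elliptic; for example, the decomposition $w=tu$ with $t\in T$, $u\in W_0$. Growth: for a finite generating set $S$ of $W$, $\ell_S(g)$ is the minimal length of a word over $S \cup S^{-1}$ representing $g$, and for $U \subseteq W$, $\beta_{U,S}(n) = |\{g \in U : \ell_S(g) \leq n\}|$ for $n \in \mathbb{N} = \{0,1,2,\ldots\}$. For $f,g \colon \mathbb{N} \to \mathbb{N}$ write $f \preccurlyeq g$ if there is an integer $\lambda \geq 1$ with $f(n) \leq \lambda g(\lambda n + \lambda) + \lambda$ for all $n$, and $f \sim g$ if $f \preccurlyeq g$ and $g \preccurlyeq f$. Up to $\sim$, the growth of a subset is independent of the finite generating set. By convention $n^0=1$. *)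

(* Defs.v *)
From HB Require Import structures.
From mathcomp Require Import all_boot all_order all_algebra.
From mathcomp Require Import finmap ring.
From mathcomp Require Import boolp classical_sets functions cardinality reals.

Set Implicit Arguments.
Unset Strict Implicit.
Unset Printing Implicit Defensive.
Import Order.TTheory GRing.Theory Num.Theory.

Local Open Scope classical_set_scope.
Local Open Scope ring_scope.

(* A group of bijections of X is represented by its set of elements, a
   [set (X -> X)], with composition as product. *)
Section GroupsOfBijections.
Variable X : choiceType.
Implicit Types (A G S U : set (X -> X)) (f g h w : X -> X).

Definition comp_op f g : X -> X := f \o g.

Definition is_inverse f g := cancel f g /\ cancel g f.

(* A `|` A^-1 *)
Definition with_inverses A : set (X -> X) :=
  [set f | A f \/ exists2 g, A g & is_inverse g f].

Definition word_product A (k : nat) f : Prop :=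
  exists a : 'I_k -> X -> X,
    (forall i, A (a i)) /\ f = \big[comp_op/id]_(i < k) a i.

(* The subgroup generated by A, when A consists of bijections. *)
Definition generated A : set (X -> X) :=
  [set f | exists k : nat, word_product (with_inverses A) k f].

(* The least length of a word over A with product f; the value 0 when no such
   word exists is a dummy. *)
Definition min_length A f : nat :=
  if pselect (exists k : nat, `[< word_product A k f >]) is left exk
  then ex_minn exk else 0%N.

Definition word_length S f : nat := min_length (with_inverses S) f.

(* [fset_set] is meaningful on finite sets only, and [word_length S] only on
   [generated S]. Both hold when S is finite and U `<=` generated S. *)
Definition growth U S (n : nat) : nat :=
  #|` fset_set [set g | U g /\ (word_length S g <= n)%N]|%N.

Definition conjugacy_class G w : set (X -> X) :=
  [set f | exists h h', [/\ G h, is_inverse h h' & f = h \o w \o h']].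

(* S `<=` G follows from the equation, hence so does the bijectivity of the
   elements of S when G consists of bijections. *)
Definition finite_generating_set G S := finite_set S /\ generated S = G.

End GroupsOfBijections.

Definition growth_le (f g : nat -> nat) : Prop :=
  exists2 l : nat, (1 <= l)%N &
    forall n : nat, (f n <= l * g (l * n + l) + l)%N.

Definition growth_equiv (f g : nat -> nat) : Prop :=
  growth_le f g /\ growth_le g f.

Section AffineCoxeterGroup.
Variables (R : realType) (V : vectType R) (ip : {dot V for (@idfun R)}).
Implicit Types (Phi : seq V) (a b x v : V) (u w t : V -> V) (j : int).

Definition cartan b a : R := 2 * ip b a / ip a a.

(* Phi is not required to be reduced, so that both usual conventions for the
   term "root system" are covered. *)
Definition crystallographic_root_system Phi : Prop :=
  [/\ <<Phi>>%VS = fullv,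
      0 \notin Phi,
      {in Phi &, forall a b, b - cartan b a *: a \in Phi}
    & {in Phi &, forall a b, cartan b a \is a Num.int}].

Definition hyperplane a j : set V := [set x | ip x a = j%:~R].

Definition affine_reflection a j : V -> V :=
  fun x => x - (2 * (ip x a - j%:~R) / ip a a) *: a.

Lemma affine_reflection_fix a j : a != 0 ->
  [set x | affine_reflection a j x = x] = hyperplane a j.
Proof.
move=> a0; have aa0 : ip a a != 0 by rewrite gt_eqF // neq0_dnorm_gt0.
apply/seteqP; split=> x /=; rewrite /affine_reflection /hyperplane /=.
  move/(canRL (subKr x)); rewrite subrr => /eqP.
  rewrite scaler_eq0 (negPf a0) orbF mulf_eq0 invr_eq0 (negPf aa0) orbF.
  by rewrite mulf_eq0 pnatr_eq0 /= subr_eq0 => /eqP.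
by move=> ->; rewrite subrr mulr0 mul0r scale0r subr0.
Qed.

Lemma affine_reflection_isometry a j x y : a != 0 ->
  let d := affine_reflection a j x - affine_reflection a j y in
  ip d d = ip (x - y) (x - y).
Proof.
move=> a0 d; have aa0 : ip a a != 0 by rewrite gt_eqF // neq0_dnorm_gt0.
have -> : d = (x - y) - cartan (x - y) a *: a.
  rewrite /d /affine_reflection /cartan linearBl /= opprD addrACA -opprD.
  rewrite -scalerBl; congr (_ - _ *: _); field.
  exact: aa0.
have sym z : ip a z = ip z a by rewrite hermC expr0 mul1r.
move: (x - y) => z; rewrite linearBl /= !linearBr /= !linearZl_LR /=.
by rewrite !linearZr_LR /= sym /cartan; field.
Qed.

Definition reflections Phi : set (V -> V) :=
  [set r | exists2 a, a \in Phi & exists j, r = affine_reflection a j].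

Definition affine_coxeter_group Phi : set (V -> V) :=
  generated (reflections Phi).

Definition reflection_length Phi w : nat := min_length (reflections Phi) w.

Definition is_translation t : Prop := exists v, t = fun x => x + v.

Definition translation_subgroup Phi : set (V -> V) :=
  affine_coxeter_group Phi `&` is_translation.

Definition elliptic u : Prop := exists x, u x = x.

Definition translation_elliptic_factorisation Phi w t u : Prop :=
  [/\ translation_subgroup Phi t, affine_coxeter_group Phi u, elliptic u
    & w = t \o u].

End AffineCoxeterGroup.

(* Main.v *)
From HB Require Import structures.
Require Import Defs.
From mathcomp Require Import all_boot all_order all_algebra.
From mathcomp Require Import finmap ring lra zify.
From mathcomp Require Import boolp classical_sets functions cardinality reals.

Set Implicit Arguments.
Unset Strict Implicit.
Unset Printing Implicit Defensive.
Import Order.TTheory GRing.Theory Num.Theory.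

Local Open Scope classical_set_scope.
Local Open Scope ring_scope.

(** An element of [W] acts as [x |-> A x + b] with [A] orthogonal and permuting
the roots.  Write [moved A] for the image of [1 - A] and [fixed A] for its
kernel; these are orthogonal complements of each other.

Growth.  Let [w x = A x + b].  Conjugating [w] by the translation by [v] adds
[(1 - A) v] to it, so the conjugacy class is a finite union of cosets of
lattices of rank [\dim (moved A)], and its growth is polynomial of that degree.
Concretely, choose roots [beta_i] whose images under [1 - A] form a basis of
[moved A].  For the lower bound, conjugating [w] by the
translations by [\sum_i c_i beta_i^vee] with [c_i < n] gives
[n ^ \dim (moved A)] distinct elements of length O(n)
([conjugacy_class_lower]).  For the upper bound, the pairings of [g 0] with the
roots are integers of size O(length of [g]), and a conjugate [g] of [w] by [h]
is determined by the permutation of the roots induced by [h] and the pairings of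
[g 0] with the images of the [beta_i] under the linear part of [h]
([conjugacy_class_ball]).

Reflection length.  It remains to see that an elliptic [u] with linear part [A]
has reflection length [\dim (moved A)] ([reflection_length_elliptic]).  Each
reflection enlarges [moved A] by at most a line, whence one inequality.  The
other is Carter's argument: if [u] is not the identity, take a reflection [r] of
[W] whose mirror contains all fixed points of [u]; its root has the form
[v - A v], and [r \o u] fixes one dimension more than [u] does.

Such an [r] exists because [W] acts freely on the points lying on no mirror
([regular_free]): a sufficiently general fixed point of [u] lies on a mirror only
if all fixed points do.  Freeness is the classical deletion argument.  Fix a
regular point [x].  A reflection [r] in the mirror [H] that is not a wall of the
chamber of [x] is a product [q r' q] of reflections whose mirrors are closer to
[x] than [H] is, so the wall reflections generate [W]; and a shortest word in wall
reflections that fixes [x] crosses its first wall twice, so that two letters can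
be deleted.  Since [u] has the same linear part as [w = t \o u], the two halves
fit together. *)

(** * Words in groups of bijections *)

Section Words.
Variable X : choiceType.
Implicit Types (A : set (X -> X)) (a f g h : X -> X) (k l : nat).

Lemma word_product0 A f : word_product A 0 f <-> f = id.
Proof.
split=> [[a [_ ->]]|->]; first by rewrite big_ord0.
by exists (fun _ => id); split=> [[]//|]; rewrite big_ord0.
Qed.

(** Words are big products over ordinals; this is the recursion on which every
induction over words rests. *)
Lemma word_productS A k f :
  word_product A k.+1 f <->
  exists a g, [/\ A a, word_product A k g & f = a \o g].
Proof.
split=> [[s [As ->]]|[a [g [Aa [s [As ->]] ->]]]].
  exists (s ord0), (\big[@comp_op X/id]_(i < k) s (lift ord0 i)).
  by split; [exact: As | exists (fun i => s (lift ord0 i)) | rewrite big_ord_recl].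
exists (fun i => oapp s a (unlift ord0 i)); split=> [i|].
  by case: unliftP => [j|] _ /=.
rewrite big_ord_recl unlift_none /=; congr (_ \o _).
by apply: eq_bigr => i _; rewrite liftK.
Qed.

Lemma word_product1 A a : A a -> word_product A 1 a.
Proof.
by move=> Aa; apply/word_productS; exists a, id; split=> //; apply/word_product0.
Qed.

Lemma word_product_comp A k l f g :
  word_product A k f -> word_product A l g -> word_product A (k + l) (f \o g).
Proof.
elim: k f => [|k IH] f; first by move/word_product0 => ->.
move=> /word_productS[a [f' [Aa wf' ->]]] wg; apply/word_productS.
by exists a, (f' \o g); split=> //; apply: IH.
Qed.

Lemma word_product_sub A B k f : A `<=` B ->
  word_product A k f -> word_product B k f.
Proof. by move=> AB [s [As ->]]; exists s; split=> // i; apply: AB. Qed.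

Lemma min_length_le A k f : word_product A k f -> (min_length A f <= k)%N.
Proof.
move=> wf; rewrite /min_length; case: pselect => // exk.
by case: ex_minnP => m _; apply; apply/asboolP.
Qed.

Lemma min_length_word A k f :
  word_product A k f -> word_product A (min_length A f) f.
Proof.
move=> wf; rewrite /min_length; case: pselect => [exk|[]].
  by case: ex_minnP => m /asboolP.
by exists k; apply/asboolP.
Qed.

Lemma sub_with_inverses A : A `<=` with_inverses A.
Proof. by move=> a; left. Qed.

Lemma is_inverse_uniq f g h : is_inverse f g -> is_inverse f h -> g = h.
Proof. by move=> [_ fg] [hf _]; apply: funext => x; rewrite -[LHS]hf fg. Qed.

Lemma is_inverse_sym f g : is_inverse f g -> is_inverse g f.
Proof. by case. Qed.

Lemma is_inverse_comp f f' g g' :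
  is_inverse f f' -> is_inverse g g' -> is_inverse (f \o g) (g' \o f').
Proof. by move=> [ff' f'f] [gg' g'g]; split; apply: can_comp. Qed.

Lemma word_product_inverse A k f : (forall a, A a -> exists a', is_inverse a a') ->
  word_product (with_inverses A) k f ->
  exists2 f', is_inverse f f' & word_product (with_inverses A) k f'.
Proof.
move=> Ainv; elim: k f => [|k IH] f.
  by move/word_product0 ->; exists id => //; apply/word_product0.
move=> /word_productS[a [g [Aa /IH[g' gg' wg'] ->]]].
have [a' aa' Aa'] : exists2 a', is_inverse a a' & with_inverses A a'.
  case: Aa => [Aa|[b Ab ba]]; last by exists b; [exact: is_inverse_sym | left].
  by have [a' aa'] := Ainv _ Aa; exists a' => //; right; exists a.
exists (g' \o a'); first exact: is_inverse_comp.
by rewrite -addn1; apply: word_product_comp => //; apply: word_product1.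
Qed.

Lemma generated_id A : generated A id.
Proof. by exists 0%N; apply/word_product0. Qed.

Lemma generated_comp A f g : generated A f -> generated A g -> generated A (f \o g).
Proof.
by move=> [k wf] [l wg]; exists (k + l)%N; apply: word_product_comp.
Qed.

Lemma sub_generated A : A `<=` generated A.
Proof. by move=> a Aa; exists 1%N; apply: word_product1; left. Qed.

(** For involutions the formal inverses add nothing, so that words in the
reflections themselves suffice to describe the affine Coxeter group. *)
Lemma generated_involutions A : (forall a, A a -> cancel a a) ->
  generated A = [set f | exists k, word_product A k f].
Proof.
move=> Ainv; apply/seteqP; split=> f [k wf]; exists k; last first.
  exact: word_product_sub (@sub_with_inverses A) wf.
apply: word_product_sub wf => a [//|[b Ab ba]].
by rewrite -(@is_inverse_uniq b b a) //; split; apply: Ainv.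
Qed.

Lemma generated_inverse A f : (forall a, A a -> exists a', is_inverse a a') ->
  generated A f -> exists2 f', is_inverse f f' & generated A f'.
Proof.
by move=> Ainv [k /(word_product_inverse Ainv)[f' ff' wf']]; exists f' => //; exists k.
Qed.

End Words.

(** * Counting *)

Section Counting.
Variable T : choiceType.
Implicit Type (G : set T).

(** The code is a relation, so that the elements of [G] can be encoded through
witnesses that are neither unique nor canonical. *)
Lemma finite_decoding (C : finType) G (code : T -> C -> Prop) :
  (forall g, G g -> exists c, code g c) ->
  (forall g g' c, G g -> G g' -> code g c -> code g' c -> g = g') ->
  finite_set G /\ (#|` fset_set G| <= #|C|)%N.
Proof.
move=> codeG code_inj.
pose decoded c := [set g | G g /\ code g c].
have subG (c0 : C) (g0 : T) : G `<=` (fun c => xget g0 (decoded c)) @` setT.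
  move=> g Gg; have [c gc] := codeG g Gg; exists c => //.
  case: xgetP => [g' _ [Gg' g'c]|/(_ g)]; last by case.
  exact: code_inj Gg' Gg g'c gc.
have [->|/set0P[g0 Gg0]] := eqVneq G set0.
  by rewrite fset_set0 cardfs0; split=> //; apply: finite_set0.
have [c0 _] := codeG g0 Gg0; have := subG c0 g0; set dec := fun _ => _ => GS.
have finI : finite_set (dec @` setT) by apply: finite_image; apply: finite_finset.
have finG : finite_set G := sub_finite_set GS finI.
split=> //; have sub : (fset_set G `<=` [fset dec c | c in C])%fset.
  apply/fsubsetP => g; rewrite in_fset_set // inE => /GS[c _ <-].
  by apply/imfsetP; exists c.
apply: leq_trans (fsubset_leq_card sub) _.
by apply: leq_trans (leq_imfset_card _ _ _) _; rewrite cardE.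
Qed.

Lemma card_fset_set_ge (C : finType) G (f : C -> T) : finite_set G ->
  injective f -> (forall c, G (f c)) -> (#|C| <= #|` fset_set G|)%N.
Proof.
move=> finG f_inj Gf.
have <- : #|` [fset f c | c in C]%fset| = #|C|.
  by rewrite card_imfset // cardE.
apply: fsubset_leq_card; apply/fsubsetP => _ /imfsetP[c _ ->].
by rewrite in_fset_set // inE.
Qed.

End Counting.

(** * Roots, reflections and the affine group they generate *)

(** With [p], [q] the square norms of two roots, [m] their inner product and [s],
[t] the levels of [x] on their hyperplanes, the square distances from [x] to the
two hyperplanes are [s ^+ 2 / p] and [t ^+ 2 / q].  The product
[t * (t - s * (m / p))] multiplies the levels on the second hyperplane of [x] and
of the foot of the perpendicular from [x] to the first one.  When it is
non-positive, the second hyperplane meets that perpendicular and is therefore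
closer to [x], and so is the image of the first hyperplane under the second
reflection.  The last hypothesis keeps the two hyperplanes from coinciding. *)
Lemma descent_inequalities (R : realFieldType) (p q m s t : R) :
  0 < p -> 0 < q -> t != 0 -> m ^+ 2 <= p * q -> t * (t - s * (m / p)) <= 0 ->
  m ^+ 2 < p * q \/ t * (t - s * (m / p)) < 0 ->
  t ^+ 2 / q < s ^+ 2 / p /\ (s - 2 * t * (m / q)) ^+ 2 / p < s ^+ 2 / p.
Proof.
move=> p0 q0 t0 mpq cross strict.
have t2 : 0 < t ^+ 2 by rewrite exprn_even_gt0.
have crossE : t * (t - s * (m / p)) = (t ^+ 2 * p - s * t * m) / p.
  by field; apply: lt0r_neq0.
rewrite crossE pmulr_lle0 ?invr_gt0 // pmulr_llt0 ?invr_gt0 // in cross strict.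
set Y := s * t * m in cross strict *.
have X0 : 0 < t ^+ 2 * p by rewrite mulr_gt0.
have Y0 : 0 < Y by lra.
have s2 : 0 < s ^+ 2.
  rewrite exprn_even_gt0 //=; apply/eqP => s0.
  by move: Y0; rewrite /Y s0 !mul0r ltxx.
have st2 : 0 < s ^+ 2 * t ^+ 2 by rewrite mulr_gt0.
split.
  rewrite ltr_pdivrMr // mulrAC ltr_pdivlMr //.
  rewrite -subr_gt0 -(pmulr_rgt0 _ X0).
  have -> : t ^+ 2 * p * (s ^+ 2 * q - t ^+ 2 * p) =
     s ^+ 2 * t ^+ 2 * (p * q - m ^+ 2) + (Y - t ^+ 2 * p) * (Y + t ^+ 2 * p).
    rewrite /Y; ring.
  have [mlt|ylt] := strict.
    rewrite ltr_wpDr //; first by rewrite mulr_ge0 //; lra.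
    by rewrite mulr_gt0 // subr_gt0.
  rewrite ltr_wpDl //; first by rewrite mulr_ge0 ?subr_ge0 // ltW.
  by rewrite mulr_gt0 //; lra.
rewrite ltr_pM2r ?invr_gt0 // -subr_gt0.
have -> : s ^+ 2 - (s - 2 * t * (m / q)) ^+ 2 =
    4 / q ^+ 2 * (t ^+ 2 * (p * q - m ^+ 2) + q * (Y - t ^+ 2 * p)).
  by rewrite /Y; field; apply: lt0r_neq0.
rewrite mulr_gt0 ?divr_gt0 ?exprn_gt0 //.
have [mlt|ylt] := strict.
  by apply: ltr_wpDr; [apply: mulr_ge0 | apply: mulr_gt0]; lra.
by apply: ltr_wpDl; [apply: mulr_ge0 | apply: mulr_gt0]; lra.
Qed.

Section RootSystem.
Variables (R : realType) (V : vectType R) (ip : {dot V for (@idfun R)}).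
Implicit Types (a b c x y v : V) (i j l : int) (A B : 'End(V)).

Lemma ipC x y : ip x y = ip y x.
Proof. by rewrite hermC expr0 mul1r. Qed.

Lemma ip_gt0 x : x != 0 -> 0 < ip x x.
Proof. exact: neq0_dnorm_gt0. Qed.

Lemma ip_eq0 x : (ip x x == 0) = (x == 0).
Proof.
apply/idP/eqP => [|->]; last by rewrite linear0l.
by apply: contraTeq => /ip_gt0 /gt_eqF ->.
Qed.

Lemma ip_ge0 x : 0 <= ip x x.
Proof. by have [->|/ip_gt0/ltW//] := eqVneq x 0; rewrite linear0l. Qed.

(** The signed position of [x] relative to the hyperplane: its sign is the side on
which [x] lies, and its zero set is the hyperplane. *)
Definition level a j x : R := ip x a - j%:~R.

Lemma affine_reflectionE a j x :
  affine_reflection ip a j x = x - (2 * level a j x / ip a a) *: a.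
Proof. by []. Qed.

Lemma level_reflection a j b i x :
  level b i (affine_reflection ip a j x) =
  level b i x - 2 * level a j x * (ip a b / ip a a).
Proof.
rewrite /level affine_reflectionE linearBl /= linearZl_LR /= /level; ring.
Qed.

Lemma level_reflection_self a j x : a != 0 ->
  level a j (affine_reflection ip a j x) = - level a j x.
Proof.
by move=> a0; rewrite level_reflection divff ?ip_eq0 // mulr1; ring.
Qed.

Lemma affine_reflectionK a j : a != 0 ->
  involutive (affine_reflection ip a j).
Proof.
move=> a0 x; rewrite affine_reflectionE level_reflection_self //.
rewrite affine_reflectionE -addrA -opprD -scalerDl.
rewrite (_ : 2 * _ / _ + _ = 0); last by ring.
by rewrite scale0r subr0.
Qed.

Definition root_reflection a x : V := x - cartan ip x a *: a.

Lemma root_reflection_is_linear a : linear (root_reflection a).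
Proof.
move=> k x y; rewrite /root_reflection /cartan linearDl /= linearZl_LR /=.
rewrite scalerBr scalerA addrACA -opprD -scalerDl; congr (_ - _ *: _); ring.
Qed.

HB.instance Definition _ a :=
  GRing.isLinear.Build R V V _ (root_reflection a) (root_reflection_is_linear a).

Lemma affine_reflection_linear_part a j x :
  affine_reflection ip a j x = root_reflection a x + (2 * j%:~R / ip a a) *: a.
Proof.
rewrite affine_reflectionE /level /root_reflection /cartan -addrA.
by rewrite -scaleNr -[in RHS]scaleNr -scalerDl; congr (_ + _ *: _); ring.
Qed.

Lemma root_reflection_isometry a x y : a != 0 ->
  ip (root_reflection a x) (root_reflection a y) = ip x y.
Proof.
move=> a0; have := ip_gt0 a0 => /lt0r_neq0 aa0.
rewrite /root_reflection linearBl /= !linearBr /= !linearZl_LR /= !linearZr_LR /=.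
by rewrite /cartan (ipC a y); field.
Qed.

Variable Phi : seq V.
Hypothesis hPhi : crystallographic_root_system ip Phi.

Lemma span_roots : <<Phi>>%VS = fullv.
Proof. by case: hPhi. Qed.

Lemma root_neq0 a : a \in Phi -> a != 0.
Proof. by case: hPhi => _ h0 _ _ aPhi; apply: contraNneq h0 => <-. Qed.

Lemma root_ip_gt0 a : a \in Phi -> 0 < ip a a.
Proof. by move/root_neq0/ip_gt0. Qed.

Let W := affine_coxeter_group ip Phi.
Let Refl := reflections ip Phi.

Lemma reflections_involutive r : Refl r -> cancel r r.
Proof. by move=> [a aPhi [j ->]]; apply/affine_reflectionK/root_neq0. Qed.

Lemma reflections_inverse r : Refl r -> exists r', is_inverse r r'.
Proof. by move=> /reflections_involutive rr; exists r. Qed.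

Lemma coxeter_word w : W w -> exists k, word_product Refl k w.
Proof.
rewrite /W /affine_coxeter_group generated_involutions //.
exact: reflections_involutive.
Qed.

Lemma reflection_in_W a j : a \in Phi -> W (affine_reflection ip a j).
Proof. by move=> aPhi; apply: sub_generated; exists a => //; exists j. Qed.

Lemma W_comp f g : W f -> W g -> W (f \o g).
Proof. exact: generated_comp. Qed.

Lemma W_inverse f : W f -> exists2 f', is_inverse f f' & W f'.
Proof. exact/generated_inverse/reflections_inverse. Qed.

Lemma word_in_W k f : word_product Refl k f -> W f.
Proof. by move=> wf; exists k; apply: word_product_sub wf => r; left. Qed.

(** Integrality of the pairings of [b] with the roots is what makes [g] permute the
hyperplanes, and what makes the possible values of [b] discrete. *)
Definition affine_symmetry (g : V -> V) A b :=
  [/\ forall x, g x = A x + b,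
      forall x y, ip (A x) (A y) = ip x y,
      {in Phi, forall a, A a \in Phi},
      {in Phi, forall a, exists2 c, c \in Phi & A c = a}
    & {in Phi, forall a, ip b a \is a Num.int}].

Lemma reflection_affine_symmetry a j : a \in Phi ->
  affine_symmetry (affine_reflection ip a j) (linfun (root_reflection a))
    ((2 * j%:~R / ip a a) *: a).
Proof.
move=> aPhi; have a0 := root_neq0 aPhi; case: hPhi => _ _ stab int.
have aa0 : ip a a != 0 by rewrite ip_eq0.
have lE := lfunE (root_reflection a).
have sPhi : {in Phi, forall c, linfun (root_reflection a) c \in Phi}.
  by move=> c cPhi; rewrite lE; apply: stab.
split=> [x|x y|//|c cPhi|c cPhi].
- by rewrite lE affine_reflection_linear_part.
- by rewrite !lE root_reflection_isometry.
- exists (root_reflection a c); first by rewrite -lE sPhi.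
  rewrite lE; have := @affine_reflectionK a 0 a0 c.
  by rewrite !affine_reflection_linear_part mulr0 mul0r scale0r !addr0.
- rewrite linearZl_LR /= (_ : _ * _ = j%:~R * cartan ip c a).
    by rewrite rpredM ?rpred_int // int.
  by rewrite /cartan (ipC a c); ring.
Qed.

Lemma affine_symmetry_comp g A b g' A' b' :
  affine_symmetry g A b -> affine_symmetry g' A' b' ->
  affine_symmetry (g \o g') (A \o A')%VF (A b' + b).
Proof.
move=> [gE iso stab onto int] [gE' iso' stab' onto' int'].
split=> [x|x y|a aPhi|a aPhi|a aPhi].
- by rewrite /= gE gE' comp_lfunE linearD addrA.
- by rewrite !comp_lfunE iso iso'.
- by rewrite comp_lfunE stab // stab'.
- have [c cPhi <-] := onto a aPhi; have [d dPhi <-] := onto' c cPhi.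
  by exists d => //; rewrite comp_lfunE.
- rewrite linearDl /= rpredD ?int //.
  by have [c cPhi <-] := onto a aPhi; rewrite iso int'.
Qed.

Lemma affine_symmetry_id : affine_symmetry id \1%VF 0.
Proof.
split=> [x|x y|a aPhi|a aPhi|a aPhi]; rewrite ?id_lfunE ?addr0 //.
- by exists a => //; rewrite id_lfunE.
- by rewrite linear0l.
Qed.

Lemma coxeter_affine_symmetry g : W g -> exists A b, affine_symmetry g A b.
Proof.
move=> /coxeter_word[k]; elim: k g => [|k IH] g.
  by move/word_product0 ->; exists \1%VF, 0; apply: affine_symmetry_id.
move=> /word_productS[_ [f [[a aPhi [j ->]] /IH[A [b fAb]] ->]]].
eexists; eexists; apply: affine_symmetry_comp fAb.
exact: reflection_affine_symmetry.
Qed.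

(** Since the linear part of [g] permutes the roots and its translation part pairs
integrally with them, [g] permutes the mirrors and conjugates their reflections
accordingly. *)
Lemma transport_reflection g a j : W g -> a \in Phi ->
  exists c l, [/\ c \in Phi, ip c c = ip a a,
    forall y, level a j (g y) = level c l y
  & affine_reflection ip a j \o g = g \o affine_reflection ip c l].
Proof.
move=> /coxeter_affine_symmetry[A [b [gE iso _ onto int]]] aPhi.
have [c cPhi Ac] := onto a aPhi; have /intrP[m bm] := int a aPhi.
have lE y : level a j (g y) = level c (j - m) y.
  by rewrite /level gE linearDl /= bm -Ac iso rmorphB /=; ring.
exists c, (j - m); split=> //; first by rewrite -Ac iso.
apply: funext => y /=; rewrite !affine_reflectionE lE !gE -Ac iso.
by rewrite addrAC -linearZ -linearB.
Qed.

(** * Free action on regular points *)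

Definition regular x := {in Phi, forall a, ip x a \isn't a Num.int}.

Section Regular.
Variable x : V.
Hypothesis x_regular : regular x.

Lemma level_neq0 g a j : W g -> a \in Phi -> level a j (g x) != 0.
Proof.
move=> Wg aPhi; have [c [l [cPhi _ -> _]]] := transport_reflection j Wg aPhi.
by rewrite subr_eq0; apply: contraNneq (x_regular cPhi) => ->; apply: rpred_int.
Qed.

Lemma level_x_neq0 a j : a \in Phi -> level a j x != 0.
Proof. have := @level_neq0 id a j (generated_id _). by []. Qed.

Definition separates a j y z := level a j y * level a j z < 0.

(** The mirrors are compared through their reflections, since proportional roots
give several parameters [(b, i)] for the same mirror. *)
Definition wall_reflection (s : V -> V) := exists a j,
  [/\ a \in Phi, s = affine_reflection ip a j
    & forall b i, b \in Phi -> separates b i x (s x) ->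
        affine_reflection ip b i = s].

Definition sqdist a j : R := level a j x ^+ 2 / ip a a.

Lemma finite_below (m : R) : exists L : seq (V * int),
  forall a j, a \in Phi -> sqdist a j <= m -> (a, j) \in L.
Proof.
pose N a := Num.bound (`|ip x a| + `|m| * ip a a + 1).
pose ints n := [seq k%:Z - n%:Z | k <- iota 0 n.*2.+1].
exists [seq (a, j) | a <- Phi, j <- ints (N a)] => a j aPhi am.
apply/allpairsPdep; exists a, j; split=> //.
suff jN : `|j| <= (N a)%:Z.
  apply/mapP; exists (absz (j + (N a)%:Z)); last by lia.
  by rewrite mem_iota; lia.
rewrite -(@ler_int R) intr_norm ltW //.
have aa := root_ip_gt0 aPhi.
apply: le_lt_trans (archi_boundP _); last first.
  by do 2![apply: addr_ge0 => //]; apply: mulr_ge0 => //; apply: ltW.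
have {}am : level a j x ^+ 2 <= `|m| * ip a a.
  by rewrite -ler_pdivrMr // (le_trans am) // ler_norm.
move: am; rewrite /level; set p := ip x a; set q := j%:~R => am.
have : `|q| <= `|p| + `|p - q|.
  by have := ler_normB p (p - q); rewrite subKr.
have : `|p - q| <= (p - q) ^+ 2 + 1.
  by rewrite -(real_normK (num_real (p - q))); move: `|p - q| => t; nra.
lra.
Qed.

(** Distances from [x] to the mirrors can serve for induction because only finitely
many mirrors lie below a given distance. *)
Lemma sqdist_ind (P : V -> int -> Prop) :
  (forall a j, a \in Phi ->
     (forall b i, b \in Phi -> sqdist b i < sqdist a j -> P b i) -> P a j) ->
  forall a j, a \in Phi -> P a j.
Proof.
move=> step a0 j0 a0Phi; have [L LP] := finite_below (sqdist a0 j0).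
pose N (d : R) := count (fun p => sqdist p.1 p.2 < d) L.
suff main n a j : a \in Phi -> sqdist a j <= sqdist a0 j0 ->
    (N (sqdist a j) < n)%N -> P a j by exact: main (ltnSn _).
elim: n a j => // n IH a j aPhi aL aN; apply: step => // b i bPhi ba.
have bL := le_trans (ltW ba) aL.
apply: IH => //; rewrite -ltnS; apply: leq_trans aN; rewrite ltnS.
have bin := LP b i bPhi bL; rewrite /N.
have /perm_to_rem/permP pL := bin; rewrite !pL /= ltxx ba add0n add1n ltnS.
by apply: sub_count => p /= /lt_trans; apply.
Qed.


Lemma proportional_reflection a j b i (k : R) : a != 0 -> k != 0 ->
  b = k *: a -> level b i x = k * level a j x ->
  affine_reflection ip b i = affine_reflection ip a j.
Proof.
move=> a0 k0 bE lE; have aa0 : ip a a != 0 by rewrite ip_eq0.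
have ik : i%:~R = k * j%:~R :> R.
  by move: lE; rewrite /level bE linearZr_LR /=; lra.
apply: funext => y; rewrite !affine_reflectionE /level ik bE.
rewrite linearZl_LR !linearZr_LR /= scalerA; congr (_ - _ *: _); field.
by rewrite aa0.
Qed.

(** If the mirror of [(b, i)] meets the segment from [x] to its foot on the mirror
of [(a, j)], then reflecting the latter mirror in the former brings it closer to
[x]; the equality case of Cauchy-Schwarz is that of parallel mirrors. *)
Lemma reflection_descent_step a j b i : a \in Phi -> b \in Phi ->
  level b i x * (level b i x - level a j x * (ip a b / ip a a)) <= 0 ->
  affine_reflection ip b i <> affine_reflection ip a j ->
  exists c l, [/\ c \in Phi, sqdist b i < sqdist a j, sqdist c l < sqdist a j
    & affine_reflection ip a j = affine_reflection ip b i
        \o affine_reflection ip c l \o affine_reflection ip b i].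
Proof.
move=> aPhi bPhi crossing neq.
have [c [l [cPhi cc lE swap]]] := transport_reflection j (reflection_in_W i bPhi) aPhi.
have t0 := level_x_neq0 i bPhi.
have [p0 q0] := (root_ip_gt0 aPhi, root_ip_gt0 bPhi).
exists c, l; rewrite /sqdist cc -lE level_reflection (ipC b a).
pose k := ip a b / ip a a.
have residual : ip (b - k *: a) (b - k *: a) = ip b b - ip a b ^+ 2 / ip a a.
  rewrite linearBl /= !linearBr /= !linearZl_LR /= !linearZr_LR /= (ipC b a) /k.
  by field; apply: lt0r_neq0.
have cauchy : ip a b ^+ 2 <= ip a a * ip b b.
  have := ip_ge0 (b - k *: a).
  by rewrite residual subr_ge0 ler_pdivrMr // mulrC.
have strict : ip a b ^+ 2 < ip a a * ip b b \/
    level b i x * (level b i x - level a j x * (ip a b / ip a a)) < 0.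
  have [/eqP|bka] := eqVneq (b - k *: a) 0; last first.
    left; have := ip_gt0 bka.
    by rewrite residual subr_gt0 ltr_pdivrMr // mulrC.
  rewrite subr_eq0 => /eqP bE; right; rewrite lt_neqAle crossing andbT.
  rewrite mulf_neq0 // subr_eq0; apply/eqP => lbE; apply: neq.
  apply: (@proportional_reflection _ _ _ _ k); rewrite ?(root_neq0 aPhi) //.
    by apply: contraTneq q0 => k0; rewrite bE k0 scale0r linear0l ltxx.
  by rewrite lbE mulrC.
have [bd cd] := descent_inequalities p0 q0 t0 cauchy crossing strict.
split=> //; apply: funext => y /=.
have := congr1 (fun f => f (affine_reflection ip b i y)) swap => /= <-.
by rewrite affine_reflectionK // root_neq0.
Qed.

(** A mirror separating [x] from its image under the reflection meets the segment
between them in one of its halves; if it is the far half, its own mirror image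
meets the near half. *)
Lemma wall_descent a j : a \in Phi -> ~ wall_reflection (affine_reflection ip a j) ->
  exists b i, [/\ b \in Phi,
    level b i x * (level b i x - level a j x * (ip a b / ip a a)) <= 0
  & affine_reflection ip b i <> affine_reflection ip a j].
Proof.
move=> aPhi nwall; have a0 := root_neq0 aPhi.
have [b [i [bPhi sep neq]]] : exists b i, [/\ b \in Phi,
    separates b i x (affine_reflection ip a j x)
  & affine_reflection ip b i <> affine_reflection ip a j].
  apply: contrapT => none; apply: nwall; exists a, j; split=> // b i bPhi sep.
  by apply: contrapT => neq; apply: none; exists b, i.
move: sep; rewrite /separates level_reflection.
set s := level a j x; set t := level b i x; set m := ip a b / ip a a => sep.
have [near|far] := lerP (t * (t - s * m)) 0; first by exists b, i.
have [c [l [cPhi cc lE swap]]] := transport_reflection i (reflection_in_W j aPhi) bPhi.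
exists c, l; split=> //; last first.
  move=> cE; apply: neq; move: swap; rewrite cE => swap.
  apply: funext => y; have := congr1 (@^~ (affine_reflection ip a j y)) swap.
  by rewrite /= !affine_reflectionK.
have ac : ip a c = - ip a b.
  have -> : ip a c = level c l a - level c l 0.
    by rewrite /level linear0l; ring.
  rewrite -!lE !level_reflection /level !linear0l; field.
  by rewrite ip_eq0.
rewrite -lE level_reflection ac mulNr -/m -/s -/t.
move: sep far; nra.
Qed.

Lemma reflection_word_walls a j : a \in Phi ->
  exists k, word_product wall_reflection k (affine_reflection ip a j).
Proof.
move: a j; apply: sqdist_ind => a j aPhi IH.
have [wall|nwall] := pselect (wall_reflection (affine_reflection ip a j)).
  by exists 1%N; apply: word_product1.
have [b [i [bPhi cross neq]]] := wall_descent aPhi nwall.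
have [c [l [cPhi ba ca ->]]] := reflection_descent_step aPhi bPhi cross neq.
have [kb wb] := IH b i bPhi ba; have [kc wc] := IH c l cPhi ca.
by exists (kb + kc + kb)%N; do 2![apply: word_product_comp => //].
Qed.

Lemma wall_in_reflections s : wall_reflection s -> Refl s.
Proof. by move=> [a [j [aPhi -> _]]]; exists a => //; exists j. Qed.

Lemma W_word_walls g : W g -> exists k, word_product wall_reflection k g.
Proof.
move=> /coxeter_word[k]; elim: k g => [|k IH] g.
  by move=> wg; exists 0%N; apply/word_product0/(word_product0 Refl).
move=> /word_productS[_ [f [[a aPhi [j ->]] /IH[m wf] ->]]].
have [n wa] := reflection_word_walls j aPhi.
by exists (n + m)%N; apply: word_product_comp.
Qed.

(** Let [f] be the product of [s_1], ..., [s_k].  The path [g x], [g (s_1 x)],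
[g (s_1 (s_2 x))], ... crosses the mirror of [(a, j)] somewhere.  The step [s]
that does so is a wall reflection, hence the mirror is an image of the wall of
[s], and reflecting in it cancels that letter. *)
Lemma exchange a j g k f : a \in Phi -> W g -> word_product wall_reflection k f ->
  separates a j (g x) (g (f x)) ->
  exists f', [/\ word_product wall_reflection k.-1 f', (0 < k)%N
    & affine_reflection ip a j \o g \o f = g \o f'].
Proof.
move=> aPhi; elim: k g f => [|k IH] g f Wg.
  by move=> /word_product0 ->; rewrite /separates -expr2 ltNge sqr_ge0.
move=> /word_productS[s [h [wall_s wh ->]]] sep.
have Ws : W s by apply: sub_generated; apply: wall_in_reflections.
have [sep1|nsep1] := pselect (separates a j (g x) (g (s x))).
  have [c [l [cPhi _ lE swap]]] := transport_reflection j Wg aPhi.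
  have cs : affine_reflection ip c l = s.
    case: wall_s => b [i [bPhi sE wall]]; apply: wall => //.
    by move: sep1; rewrite /separates !lE.
  exists h; split=> //.
  rewrite swap cs; apply: funext => y /=; congr (g _).
  exact/reflections_involutive/wall_in_reflections.
have [|f' [wf' k0 swap]] := IH (g \o s) h (W_comp Wg Ws) wh.
  move: sep nsep1; rewrite /separates /= => sep /negP; rewrite -leNgt le0r.
  have := level_neq0 j Wg aPhi; have := level_neq0 j (W_comp Wg Ws) aPhi => /=.
  move=> /negPf gs0 /negPf g0; rewrite mulf_eq0 gs0 g0 /= => pos.
  move: sep pos gs0 g0; move: (level _ _ _) (level _ _ _) (level _ _ _) => p q r.
  nra.
exists (s \o f'); split=> //.
by case: k k0 wf' {IH wh} => // k _ wf'; apply/word_productS; exists s, f'.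
Qed.

(** Write [g = s \o h] with [s] the first wall reflection of a word for [g].
The path from [x] to [g x = x] crosses the wall of [s] at its first step and
therefore crosses back during [h]; by [exchange] both letters can be dropped. *)
Lemma regular_free g : W g -> g x = x -> g = id.
Proof.
move=> /W_word_walls[k]; elim/ltn_ind: k g => -[|k] IH g; first by move/word_product0.
move=> /word_productS[s [h [wall_s wh gE]]] gx.
have Ws : W s by apply: sub_generated; apply: wall_in_reflections.
have := wall_s => -[a [j [aPhi sE _]]].
have [|f' [wf' k0 swap]] := @exchange a j s k h aPhi Ws wh.
  rewrite /separates -[s (h x)]/((s \o h) x) -gE gx sE.
  rewrite level_reflection_self ?root_neq0 // mulNr oppr_lt0.
  by rewrite -expr2 exprn_even_gt0 //= level_x_neq0.
have gE' : g = f'.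
  rewrite gE; apply: funext => y; have := congr1 (fun q => s (q y)) swap.
  by rewrite /= sE !affine_reflectionK ?root_neq0 // -sE.
rewrite gE' in gx *; apply: IH wf' gx.
by rewrite ltnS (leq_trans (leq_pred k)).
Qed.
End Regular.
End RootSystem.

(** * Reflection length of elliptic elements *)

Lemma noninteger_near (R : archiRealFieldType) (c : R) : exists2 e : R, 0 < e &
  forall y, `|y| < e -> (c \isn't a Num.int) || (y != 0) ->
    c + y \isn't a Num.int.
Proof.
have [cint|cNint] := boolP (c \is a Num.int).
  exists 1 => // y y1 /= y0; apply: contra y0 => cy.
  have /intrP[m ym] : y \is a Num.int by rewrite -(addKr c y) addrC rpredB.
  by move: y1; rewrite ym -intr_norm intr_eq0 (_ : 1 = 1%:~R) // ltr_int; lia.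
have /andP[fl fr] := floor_itv c.
have {}fl : (Num.floor c)%:~R < c.
  by rewrite lt_neqAle fl andbT; apply: contraNneq cNint => <-; apply: rpred_int.
exists (Num.min (c - (Num.floor c)%:~R) ((Num.floor c + 1)%:~R - c)).
  by rewrite lt_min !subr_gt0 fl.
move=> y; rewrite lt_min !ltr_norml => /andP[/andP[y1 _] /andP[_ y2]] _.
apply/negP => /intrP[m cm].
have m1 : (Num.floor c)%:~R < m%:~R :> R by rewrite -cm; lra.
have m2 : m%:~R < (Num.floor c + 1)%:~R :> R by rewrite -cm; lra.
by move: m1 m2; rewrite !ltr_int; lia.
Qed.

Lemma noninteger_perturbation (R : archiRealFieldType) (T : eqType) (L : seq T)
    (c d : T -> R) :
  {in L, forall i, (c i \isn't a Num.int) || (d i != 0)} ->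
  exists2 e : R, 0 < e & forall h, 0 < h < e ->
    {in L, forall i, c i + h * d i \isn't a Num.int}.
Proof.
elim: L => [|i L IH] cd; first by exists 1.
have [j jL|e e0 eP] := IH; first by apply: cd; rewrite inE jL orbT.
have [e' e'0 e'P] := noninteger_near (c i).
have d0 : 0 < `|d i| + 1 by rewrite ltr_wpDl.
exists (Num.min e (e' / (`|d i| + 1))); first by rewrite lt_min e0 divr_gt0.
move=> h /andP[h0]; rewrite lt_min ltr_pdivlMr // => /andP[he he'] j.
rewrite inE => /predU1P[->|]; last by apply: eP; rewrite h0.
apply: e'P; first by rewrite normrM (gtr0_norm h0); nra.
by rewrite mulf_eq0 (gt_eqF h0) /= cd // inE eqxx.
Qed.

Section Elliptic.
Variables (R : realType) (V : vectType R) (ip : {dot V for (@idfun R)}).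
Implicit Types (a b c x y v z : V) (i j l : int) (A B : 'End(V)).

(** Within a coset of [U] one can avoid the hyperplanes that are not parallel to
[U]: for each vector of the list not orthogonal to [U], a sufficiently small move
along [U] makes its pairing non-integral and preserves the non-integral pairings
obtained before. *)
Lemma generic_translate (U : {vspace V}) (L : seq V) x :
  exists2 v, v \in U & {in L, forall a, ip (x + v) a \is a Num.int ->
    {in U, forall z, ip z a = 0}}.
Proof.
elim: L => [|a L [v vU vP]]; first by exists 0; rewrite ?mem0v.
have [orth|/existsNP[z /not_implyP[zU /eqP za]]] :=
    pselect (forall z, z \in U -> ip z a = 0).
  by exists v => // b; rewrite inE => /predU1P[-> _ z|/vP] //; apply: orth.
pose L' := [seq b <- a :: L | (ip (x + v) b \isn't a Num.int) || (ip z b != 0)].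
have [|e e0 eP] := @noninteger_perturbation R _ L'
    (fun b => ip (x + v) b) (fun b => ip z b).
  by move=> b; rewrite mem_filter => /andP[].
have h0 : 0 < e / 2 < e by rewrite divr_gt0 //= ltr_pdivrMr //; lra.
exists (v + (e / 2) *: z); first by rewrite memvD ?memvZ.
move=> b bL; rewrite addrA linearDl /= linearZl_LR /= => bint.
have : b \notin L' by apply: contraL bint; exact: eP.
rewrite mem_filter bL andbT negb_or !negbK => /andP[bint' /eqP zb].
move: bL; rewrite inE => /predU1P[ba|/vP]; last exact.
by move: za; rewrite -ba zb eqxx.
Qed.

Definition moved A : {vspace V} := limg (\1 - A)%VF.
Definition fixed A : {vspace V} := lker (\1 - A)%VF.

Lemma fixedP A z : reflect (A z = z) (z \in fixed A).
Proof.
rewrite memv_ker add_lfunE opp_lfunE id_lfunE subr_eq0 eq_sym; exact: eqP.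
Qed.

Lemma movedP A z : reflect (exists v, z = v - A v) (z \in moved A).
Proof.
apply: (iffP memv_imgP) => [[v _ ->]|[v ->]]; exists v.
- by rewrite add_lfunE opp_lfunE id_lfunE.
- by rewrite memvf.
- by rewrite add_lfunE opp_lfunE id_lfunE.
Qed.

Lemma dim_fixed_moved A : (\dim (fixed A) + \dim (moved A))%N = \dim {:V}.
Proof. by rewrite -(limg_ker_dim (\1 - A)%VF fullv) capfv. Qed.

Lemma moved_orthogonal_fixed A : (forall x y, ip (A x) (A y) = ip x y) ->
  {in moved A & fixed A, forall y z, ip y z = 0}.
Proof.
move=> iso _ z /movedP[v ->] /fixedP Az.
by rewrite linearBl /= -{2}Az iso subrr.
Qed.

(** The dimensions add up by rank-nullity, and orthogonality makes the sum direct. *)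
Lemma fixed_moved_full A : (forall x y, ip (A x) (A y) = ip x y) ->
  (fixed A + moved A)%VS = fullv.
Proof.
move=> iso; apply/eqP; rewrite eqEdim subvf /= -(dim_fixed_moved A).
rewrite dimv_disjoint_sum //; apply/eqP; rewrite -subv0; apply/subvP => y.
rewrite memv_cap memv0 => /andP[yf ym]; rewrite -(ip_eq0 ip).
by rewrite (moved_orthogonal_fixed iso).
Qed.

Lemma orthogonal_fixed_moved A a : (forall x y, ip (A x) (A y) = ip x y) ->
  {in fixed A, forall z, ip z a = 0} -> a \in moved A.
Proof.
move=> iso orth; have := memvf a; rewrite -(fixed_moved_full iso).
move=> /memv_addP[f ff [m mm aE]].
suff : ip f f == 0 by rewrite ip_eq0 => /eqP f0; rewrite aE f0 add0r.
apply/eqP.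
have := orth f ff; rewrite aE linearDr /= (ipC ip f m).
by rewrite (moved_orthogonal_fixed iso mm ff) addr0 => ->.
Qed.

Variable Phi : seq V.
Hypothesis hPhi : crystallographic_root_system ip Phi.
Let W := affine_coxeter_group ip Phi.
Let Refl := reflections ip Phi.

Lemma linear_part_uniq g A b A' b' :
  affine_symmetry ip Phi g A b -> affine_symmetry ip Phi g A' b' -> A = A'.
Proof.
move=> [gE _ _ _ _] [gE' _ _ _ _]; apply/lfunP => x.
have := gE x; have := gE 0; rewrite gE' (gE' x) !linear0 !add0r => ->.
by move/addIr.
Qed.

Lemma affine_symmetry_reflection_comp a j g A b : a \in Phi ->
  affine_symmetry ip Phi g A b -> exists b',
  affine_symmetry ip Phi (affine_reflection ip a j \o g)
    (linfun (root_reflection ip a) \o A)%VF b'.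
Proof.
move=> aPhi gA; eexists; apply: affine_symmetry_comp gA.
exact: reflection_affine_symmetry.
Qed.

(** For a reflection with linear part [s], [1 - s A = (1 - A) + (1 - s) A], and the
image of [1 - s] is the line spanned by the root. *)
Lemma dim_moved_le_word k u A b : word_product Refl k u ->
  affine_symmetry ip Phi u A b -> (\dim (moved A) <= k)%N.
Proof.
elim: k u A b => [|k IH] u A b.
  move=> /word_product0 -> /linear_part_uniq.
  move=> /(_ _ _ (affine_symmetry_id ip Phi)) ->.
  suff -> : moved \1 = 0%VS by rewrite dimv0.
  apply/eqP; rewrite -subv0; apply/subvP => z /movedP[v ->].
  by rewrite id_lfunE subrr mem0v.
move=> /word_productS[_ [f [[a aPhi [j ->]] wf ->]]].
have [B [d fB]] := coxeter_affine_symmetry hPhi (word_in_W wf).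
have [d' rfB] := affine_symmetry_reflection_comp j aPhi fB.
move=> uA; rewrite (linear_part_uniq uA rfB).
apply: (@leq_trans (\dim (moved B + <[a]>))).
  apply/dimvS/subvP => z /movedP[v ->]; rewrite comp_lfunE lfunE /=.
  rewrite /root_reflection opprB addrCA addrC; apply: memv_add.
    by apply/movedP; exists v.
  by rewrite memvZ // memv_line.
apply: leq_trans (dimv_add_leqif _ _) _; rewrite -addn1 leq_add ?(IH _ _ _ wf fB) //.
by rewrite dim_vline leq_b1.
Qed.

(** A generic fixed point of [u] is not regular, since [W] acts freely on regular
points; and a mirror through a generic fixed point contains all of them. *)
Lemma reflection_through_fixed u A b x : W u -> affine_symmetry ip Phi u A b ->
  u x = x -> u <> id -> exists a j, [/\ a \in Phi, level ip a j x = 0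
    & {in fixed A, forall z, ip z a = 0}].
Proof.
move=> Wu [uE _ _ _ _] ux nid.
have [v vf vP] := generic_translate (fixed A) Phi x.
have uxv : u (x + v) = x + v.
  by move: ux; rewrite !uE linearD /= (fixedP _ _ vf) addrAC => ->.
have /existsNP[a /not_implyP[aPhi /negP/negPn aint]] : ~ regular ip Phi (x + v).
  by move=> reg; apply: nid; apply: regular_free Wu uxv.
have orth := vP a aPhi aint; have /intrP[j jE] := aint.
exists a, j; split=> //; rewrite /level -jE linearDl /= (orth v vf); ring.
Qed.

(** Take a mirror containing the fixed points of [u], with root [a = v - A v].
Since [v] and [A v = v - a] have the same length, reflecting along [a] exchanges
them; so the linear part of the reflection times [u] fixes [v] in addition to
everything that [A] fixes. *)
Lemma elliptic_word u A b x : W u -> affine_symmetry ip Phi u A b -> u x = x ->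
  exists2 k, (k <= \dim (moved A))%N & word_product Refl k u.
Proof.
have [n] := ubnP (\dim (moved A)); elim: n u A b => // n IH u A b dn Wu uA ux.
have [->|nid] := pselect (u = id); first by exists 0%N; last exact/word_product0.
have [a [j [aPhi ax orth]]] := reflection_through_fixed Wu uA ux nid.
have a0 := root_neq0 hPhi aPhi; have aa := root_ip_gt0 hPhi aPhi.
have [d ruA] := affine_symmetry_reflection_comp j aPhi uA.
case: (uA) => uE iso _ _ _.
have /movedP[v aE] := orthogonal_fixed_moved iso orth.
have Av : A v = v - a by rewrite aE subKr.
have va : 2 * ip v a = ip a a.
  have := iso v v; rewrite Av linearBl /= !linearBr /= (ipC ip a v); lra.
set A1 := (_ \o A)%VF in ruA.
have A1E z : A1 z = root_reflection ip a (A z) by rewrite comp_lfunE lfunE.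
have A1v : A1 v = v.
  rewrite A1E Av /root_reflection /cartan linearBl /= (_ : _ / _ = -1).
    by rewrite scaleN1r opprK subrK.
  by rewrite mulrBr va; field; apply: lt0r_neq0.
have fixA1 : (fixed A + <[v]> <= fixed A1)%VS.
  rewrite subv_add -memvE; apply/andP; split; last exact/fixedP.
  apply/subvP => z zf; apply/fixedP; rewrite A1E (fixedP _ _ zf).
  by rewrite /root_reflection /cartan orth // mulr0 mul0r scale0r subr0.
have dimA1 : (\dim (moved A1) < \dim (moved A))%N.
  have fA : (fixed A <= fixed A1)%VS by apply: subv_trans fixA1; apply: addvSl.
  suff lt : (\dim (fixed A) < \dim (fixed A1))%N.
    by have := dim_fixed_moved A; have := dim_fixed_moved A1; lia.
  rewrite ltn_neqAle dimvS // andbT; apply: contraNneq a0 => /eqP.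
  rewrite (dimv_leqif_sup fA) => sub.
  have /fixedP : v \in fixed A by apply: subvP sub _ _; apply/fixedP.
  by move=> fv; rewrite aE fv subrr.
have [|||k kle wk] := IH _ A1 d _ _ ruA _.
- exact: leq_trans dimA1 _.
- by apply: generated_comp => //; apply: reflection_in_W.
- by rewrite /= ux affine_reflectionE ax mulr0 mul0r scale0r subr0.
exists k.+1; first exact: leq_ltn_trans kle dimA1.
apply/word_productS; exists (affine_reflection ip a j), (affine_reflection ip a j \o u).
split=> //; first by exists a => //; exists j.
by apply: funext => y /=; rewrite affine_reflectionK.
Qed.

Lemma reflection_length_elliptic u A b : W u -> affine_symmetry ip Phi u A b ->
  elliptic u -> reflection_length ip Phi u = \dim (moved A).
Proof.
move=> Wu uA [x ux]; apply/eqP; rewrite eqn_leq.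
have [k kle wk] := elliptic_word Wu uA ux.
rewrite (leq_trans (min_length_le wk)) //=.
exact: dim_moved_le_word (min_length_word wk) uA.
Qed.

End Elliptic.

(** * Growth of conjugacy classes *)

Lemma uniform_bound (T : eqType) (L : seq T) (P : T -> nat -> Prop) :
  (forall x m n, (m <= n)%N -> P x m -> P x n) ->
  {in L, forall x, exists n, P x n} -> exists n, {in L, forall x, P x n}.
Proof.
move=> mono; elim: L => [|x L IH] PL; first by exists 0%N.
have [y yL|n nP] := IH; first by apply: PL; rewrite inE yL orbT.
have [m mP] := PL x (mem_head _ _); exists (maxn m n) => y.
rewrite inE => /predU1P[->|yL]; first exact: mono (leq_maxl m n) mP.
exact: mono (leq_maxr m n) (nP y yL).
Qed.

Lemma free_image_subseq (K : fieldType) (U V : vectType K) (f : 'Hom(U, V))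
    (X : seq U) : exists Y : seq U,
  [/\ {subset Y <= X}, free (map f Y) & <<map f Y>>%VS = <<map f X>>%VS].
Proof.
elim: X => [|x X [Y [YX freeY spanY]]]; first by exists [::]; rewrite nil_free.
have YxX y : y \in Y -> y \in x :: X by move/YX; rewrite inE orbC => ->.
have [fx|fx] := boolP (f x \in <<map f Y>>%VS).
  exists Y; split=> //=; rewrite span_cons -spanY.
  by apply/esym/addv_idPr; rewrite -memvE.
exists (x :: Y); split=> /=; last by rewrite !span_cons spanY.
  by move=> y; rewrite inE => /predU1P[->|/YxX//]; rewrite mem_head.
by rewrite free_cons fx.
Qed.

Section Growth.
Variables (R : realType) (V : vectType R) (ip : {dot V for (@idfun R)}).
Implicit Types (a b x y v z : V) (A B : 'End(V)).
Variable Phi : seq V.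
Hypothesis hPhi : crystallographic_root_system ip Phi.
Let W := affine_coxeter_group ip Phi.

(** The chosen roots span a complement of [fixed A], so a vector of [moved A]
orthogonal to them is orthogonal to the whole space. *)
Lemma root_transversal A : (forall x y, ip (A x) (A y) = ip x y) ->
  exists B : seq V, [/\ {subset B <= Phi}, size B = \dim (moved A),
    free (map (\1 - A)%VF B)
  & {in moved A, forall z, {in B, forall b, ip z b = 0} -> z = 0}].
Proof.
move=> iso; have [B [BPhi freeB spanB]] := free_image_subseq (\1 - A)%VF Phi.
have spanBA : <<map (\1 - A)%VF B>>%VS = moved A.
  by rewrite spanB -limg_span (span_roots hPhi).
exists B; split=> //.
  by rewrite -spanBA -(size_map (\1 - A)%VF); apply/esym/eqP.
move=> z zm zB; apply/eqP; rewrite -(ip_eq0 ip); apply/eqP.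
have /memv_imgP[y yB] : (\1 - A)%VF z \in ((\1 - A)%VF @: <<B>>)%VS.
  by rewrite limg_span spanBA memv_img ?memvf.
move/eqP; rewrite -subr_eq0 -linearB /= -memv_ker => zyf.
rewrite -{2}(subrK y z) linearDr /= (moved_orthogonal_fixed iso) // add0r.
move: yB; rewrite -[B]/(val (in_tuple B)) => /coord_span ->.
rewrite linear_sumr big1 // => i _; rewrite linearZr_LR /= zB ?mulr0 //.
exact: mem_nth.
Qed.

(** The largest absolute value of the pairing of a vector with a root is a norm
invariant under the linear parts of [W], so that this bound on [g 0] is
subadditive on [W]. *)
Definition height_le (n : nat) (g : V -> V) :=
  {in Phi, forall a, `|ip (g 0) a| <= n%:R}.

Lemma height_le_mono g m n : (m <= n)%N -> height_le m g -> height_le n g.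
Proof. by move=> mn gm a /gm /le_trans; apply; rewrite ler_nat. Qed.

Lemma height_le_comp m n f g : W f -> height_le m f -> height_le n g ->
  height_le (m + n) (f \o g).
Proof.
move=> /(coxeter_affine_symmetry hPhi)[A [b [fE iso _ onto _]]] fm gn a aPhi.
have [c cPhi Ac] := onto a aPhi.
have -> : (f \o g) 0 = A (g 0) + f 0 by rewrite /= !fE linear0 add0r.
rewrite linearDl /= -{1}Ac iso addrC natrD.
by apply: le_trans (ler_normD _ _) _; apply: lerD; [exact: fm | exact: gn].
Qed.

Lemma height_exists g : exists n, height_le n g.
Proof.
apply: uniform_bound => [a m n mn am|a aPhi].
  by apply: le_trans am _; rewrite ler_nat.
exists (Num.bound `|ip (g 0) a|); apply: ltW; exact: archi_boundP.
Qed.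

Variable S : set (V -> V).
Hypothesis hS : finite_generating_set W S.
Let SV := with_inverses S.

Lemma S_sub_W : S `<=` W.
Proof. by case: hS => _ <-; apply: sub_generated. Qed.

Lemma S_inverse s : S s -> exists s', is_inverse s s'.
Proof. by move=> /S_sub_W /(W_inverse hPhi)[s' ss' _]; exists s'. Qed.

Lemma SV_sub_W : SV `<=` W.
Proof.
move=> s [/S_sub_W//|[r /S_sub_W /(W_inverse hPhi)[r' rr' Wr'] rs]].
by rewrite -(is_inverse_uniq rr' rs).
Qed.

Lemma W_SV_word g : W g -> exists k, word_product SV k g.
Proof. by case: hS => _ <-. Qed.

Lemma generators_height : exists K, forall s, SV s -> height_le K s.
Proof.
have [/finite_seqP[L SL] _] := hS.
pose P s n := height_le n s /\ forall s', is_inverse s s' -> height_le n s'.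
have [s m n mn [sm sm']|s sL|K KP] := @uniform_bound _ L P.
- by split=> [|s' ss']; apply: (height_le_mono mn) => //; apply: sm'.
- have [s' ss'] : exists s', is_inverse s s' by apply: S_inverse; rewrite SL.
  have [[m sm] [n sn]] := (height_exists s, height_exists s').
  exists (maxn m n); split=> [|s'' /(is_inverse_uniq ss') <-].
    exact: height_le_mono (leq_maxl _ _) sm.
  exact: height_le_mono (leq_maxr _ _) sn.
exists K => s [Ss|[r Sr rs]]; first by case: (KP s _) => //; move: Ss; rewrite SL.
by case: (KP r _) => [|_]; [move: Sr; rewrite SL | apply].
Qed.

Lemma height_le_word K k g : (forall s, SV s -> height_le K s) ->
  word_product SV k g -> height_le (K * k) g.
Proof.
move=> KP; elim: k g => [|k IH] g.
  by move=> /word_product0 -> a _; rewrite linear0l normr0.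
move=> /word_productS[s [h [Ss wh ->]]]; rewrite mulnS.
by apply: height_le_comp; [exact: SV_sub_W | exact: KP | exact: IH].
Qed.

Definition short (n : nat) g := exists2 m, (m <= n)%N & word_product SV m g.

Lemma word_length_short n g : W g -> (word_length S g <= n)%N -> short n g.
Proof.
by move=> /W_SV_word[k wk] gn; exists (word_length S g); last exact: min_length_word wk.
Qed.

Lemma short_word_length n g : short n g -> (word_length S g <= n)%N.
Proof. by move=> [m mn wm]; apply: leq_trans mn; apply: min_length_le. Qed.

Lemma short_id n : short n id.
Proof. by exists 0%N => //; apply/word_product0. Qed.

Lemma short_comp m n f g : short m f -> short n g -> short (m + n) (f \o g).
Proof.
move=> [k km wf] [l ln wg]; exists (k + l)%N; first exact: leq_add.
exact: word_product_comp.
Qed.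

Lemma short_mono m n g : (m <= n)%N -> short m g -> short n g.
Proof. by move=> mn [k km wk]; exists k => //; apply: leq_trans mn. Qed.

Lemma short_inverse n f f' : is_inverse f f' -> short n f -> short n f'.
Proof.
move=> ff' [m mn /(word_product_inverse S_inverse)[f'' ff'' wf'']].
by exists m; rewrite // (is_inverse_uniq ff' ff'').
Qed.

Variables (w : V -> V) (A : 'End(V)) (b : V).
Hypotheses (Ww : W w) (wA : affine_symmetry ip Phi w A b).

(** Conjugates by elements with the same linear part [H] differ by a translation:
the linear part [H A H^-1] involves [H] only. *)
Lemma conjugate_at h h' H d x :
  affine_symmetry ip Phi h H d -> is_inverse h h' ->
  (h \o w \o h') (H x) = H (A x) + (h \o w \o h') 0.
Proof.
case: wA => wE _ _ _ _ [hE _ _ _ _] [hh' h'h].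
have -> : H x = h (x + h' 0).
  by rewrite hE linearD /= -addrA -hE h'h addr0.
by rewrite /= hh' !hE !wE !linearD /= !addrA.
Qed.

Lemma conjugate_origin h h' H d : affine_symmetry ip Phi h H d -> is_inverse h h' ->
  exists2 m, m \in moved A & (h \o w \o h') 0 = H (b - m).
Proof.
case: wA => wE _ _ _ _ [hE _ _ _ _] [hh' h'h].
exists (h' 0 - A (h' 0)); first by apply/movedP; exists (h' 0).
have d0 : d = - H (h' 0) by apply/eqP; rewrite -addr_eq0 addrC -hE h'h.
by rewrite /= hE wE d0 -linearB /= opprB addrCA addrA.
Qed.

Let class_ball n := [set g | conjugacy_class W w g /\ (word_length S g <= n)%N].

(** A conjugate [g = h \o w \o h'] has [g 0 = H (b - m)] with [H] the linear
part of [h] and [m] in [moved A].  Its pairings with the images under [H] of a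
root transversal determine [m], and [H] is determined by how it permutes the
roots. *)
Lemma conjugacy_class_ball K Kb n :
  (forall s, SV s -> height_le K s) -> height_le Kb w ->
  finite_set (class_ball n) /\ (growth (conjugacy_class W w) S n <=
    size Phi ^ size Phi * ((K * n + Kb).*2.+1) ^ \dim (moved A))%N.
Proof.
move=> KP wKb; have [wE iso _ _ bint] := wA.
have [B [BPhi sB _ Binj]] := root_transversal iso.
set N := (K * n + Kb)%N.
(* The integral pairings lie between - N and N; adding N makes them ordinals. *)
pose code g (p : {ffun 'I_(size Phi) -> 'I_(size Phi)} *
                 {ffun 'I_(size B) -> 'I_(N.*2.+1)}) :=
  exists h h' H d, [/\ affine_symmetry ip Phi h H d, is_inverse h h',
    g = h \o w \o h', forall i : 'I_(size Phi), H Phi`_i = Phi`_(p.1 i)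
    & forall i : 'I_(size B), ip (g 0) (H B`_i) - ip b B`_i = (p.2 i)%:R - N%:R].
have [||fin card] := @finite_decoding _ _ (class_ball n) code.
- move=> g [[h [h' [Wh hh' gE]]] gn].
  have [H [d hH]] := coxeter_affine_symmetry hPhi Wh.
  have Wg : W g.
    rewrite gE; apply: W_comp; first exact: W_comp.
    by have [h'' hh'' Wh''] := W_inverse hPhi Wh; rewrite (is_inverse_uniq hh' hh'').
  have [G [e [gE0 _ _ _ gint]]] := coxeter_affine_symmetry hPhi Wg.
  have [_ _ HPhi _ _] := hH.
  have [k kn wk] := word_length_short Wg gn.
  have gheight := height_le_mono (leq_mul (leqnn K) kn) (height_le_word KP wk).
  have [i|sg sgP] := @fin_all_exists _ _
      (fun (i : 'I_(size Phi)) (j : 'I_(size Phi)) => H Phi`_i = Phi`_j).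
    have HPi : H Phi`_i \in Phi by apply: HPhi; apply: mem_nth.
    have idx : (index (H Phi`_i)%R Phi < size Phi)%N by rewrite index_mem.
    by exists (Ordinal idx); rewrite /= nth_index.
  have [i|z zP] := @fin_all_exists _ _
      (fun (i : 'I_(size B)) (j : 'I_(N.*2.+1)) =>
         ip (g 0) (H B`_i) - ip b B`_i = j%:R - N%:R).
    have BiPhi : B`_i \in Phi by apply: BPhi; apply: mem_nth.
    have /intrP[t tE] : ip (g 0) (H B`_i) - ip b B`_i \is a Num.int.
      by rewrite rpredB ?bint // gE0 linear0 add0r gint // HPhi.
    have tN : `|t| <= N%:Z.
      rewrite -(@ler_int R) intr_norm -tE; apply: le_trans (ler_normB _ _) _.
      rewrite /N -[(K * n + Kb)%:Z%:~R]/((K * n + Kb)%:R) natrD.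
      apply: lerD; first by apply: gheight; apply: HPhi.
      by have := wKb _ BiPhi; rewrite wE linear0 add0r.
    have jN : (absz (t + N%:Z)%R < N.*2.+1)%N by lia.
    exists (Ordinal jN) => /=; rewrite tE.
    have aE : (absz (t + N%:Z))%:Z = t + N%:Z by lia.
    have := congr1 (fun u : int => u%:~R : R) aE; rewrite intrD -!pmulrn => ->.
    by rewrite addrK.
  exists ([ffun i => sg i], [ffun i => z i]), h, h', H, d.
  by split=> // i; rewrite ffunE.
- move=> g g' p _ _ [h [k [H [d [hH hk gE HPhi HB]]]]].
  move=> [h' [k' [H' [d' [hH' hk' gE' HPhi' HB']]]]].
  have HH : H = H'.
    apply/(fullv_lfunP _ _ (span_roots hPhi)) => a /(nthP 0)[i iP <-].
    by rewrite (HPhi (Ordinal iP)) (HPhi' (Ordinal iP)).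
  subst H'.
  have [m mA g0] := conjugate_origin hH hk; have [m' mA' g0'] := conjugate_origin hH' hk'.
  rewrite -gE in g0; rewrite -gE' in g0'.
  have [_ Hiso _ _ _] := hH.
  have mm : m = m'.
    apply/eqP; rewrite -subr_eq0; apply/eqP; apply: Binj; first by rewrite memvB.
    move=> _ /(nthP 0)[i iB <-].
    have := HB (Ordinal iB); rewrite -(HB' (Ordinal iB)) g0 g0' !Hiso /=.
    rewrite !linearBl /=; lra.
  have g00 : g 0 = g' 0 by rewrite g0 g0' mm.
  have [hE _ _ _ _] := hH; have [hk1 hk2] := hk.
  apply: funext => z; have -> : z = H (k (z + d)).
    by apply: (addIr d); rewrite -hE hk2.
  rewrite gE gE' (conjugate_at _ hH hk) (conjugate_at _ hH' hk').
  by rewrite -gE -gE' g00.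
rewrite !card_prod !card_ffun !card_ord sB in card.
by [].
Qed.

Definition translation v x : V := x + v.

Definition coroot a : V := (2 / ip a a) *: a.

Lemma translation_inverse v : is_inverse (translation v) (translation (- v)).
Proof. by split=> x; rewrite /translation ?addrK ?subrK. Qed.

Lemma translation_coroot a : a \in Phi -> translation (coroot a) =
  affine_reflection ip a 1 \o affine_reflection ip a 0.
Proof.
move=> aPhi; have a0 := root_neq0 hPhi aPhi; apply: funext => x /=.
rewrite affine_reflectionE level_reflection divff ?ip_eq0 // affine_reflectionE.
rewrite -addrA -opprD -scalerDl /translation /coroot -scaleNr /level.
by congr (_ + _ *: _); ring.
Qed.

Lemma coroot_translations_short :
  exists n, {in Phi, forall a, short n (translation (coroot a))}.
Proof.
apply: uniform_bound => [a m n mn|a aPhi]; first exact: short_mono.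
have [k wk] : exists k, word_product SV k (translation (coroot a)).
  apply: W_SV_word; rewrite translation_coroot //.
  by apply: W_comp; apply: reflection_in_W.
by exists k, k.
Qed.

Lemma short_translationMn n v k :
  short n (translation v) -> short (k * n) (translation (v *+ k)).
Proof.
move=> vn; elim: k => [|k IH].
  rewrite (_ : translation _ = id); first exact: short_id.
  by apply: funext => x; rewrite /translation addr0.
rewrite mulSn (_ : translation _ = translation v \o translation (v *+ k)).
  exact: short_comp.
by apply: funext => x; rewrite /translation /= mulrSr addrA.
Qed.

Lemma short_translation_sum n k (v : 'I_k -> V) :
  (forall i, short n (translation (v i))) ->
  short (k * n) (translation (\sum_(i < k) v i)).
Proof.
elim: k v => [|k IH] v vn.
  rewrite (_ : translation _ = id); first exact: short_id.
  by apply: funext => x; rewrite /translation big_ord0 addr0.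
rewrite big_ord_recl mulSn addrC.
rewrite (_ : translation _ = translation (v ord0) \o
  translation (\sum_(i < k) v (lift ord0 i))).
  by apply: short_comp => //; apply: IH.
by apply: funext => x; rewrite /translation /= addrA.
Qed.

Lemma short_in_W n g : short n g -> W g.
Proof. by case: hS => _ <- [m _ wm]; exists m. Qed.

(** The conjugates of [w] by the translations along non-negative combinations of the
coroots of a root transversal are pairwise distinct. *)
Lemma conjugacy_class_lower : exists D D', forall n,
  (n ^ \dim (moved A) <= growth (conjugacy_class W w) S (D * n + D'))%N.
Proof.
have [wE iso _ _ _] := wA.
have [B [BPhi sB freeB _]] := root_transversal iso.
have [L LP] := coroot_translations_short.
have [lw ww] := W_SV_word Ww.
set k := size B in sB.
exists (k * L).*2, lw => n.
pose v (c : {ffun 'I_k -> 'I_n}) := \sum_(i < k) coroot B`_i *+ c i.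
have v_short (c : {ffun 'I_k -> 'I_n}) : short (k * (n * L)) (translation (v c)).
  apply: short_translation_sum => i.
  apply: short_mono (short_translationMn _ (LP B`_i _)).
    by rewrite leq_mul2r ltnW ?orbT.
  by apply: BPhi; apply: mem_nth.
pose f (c : {ffun 'I_k -> 'I_n}) := translation (v c) \o w \o translation (- v c).
have f_inj : injective f.
  have f0 c : f c 0 = b + (\1 - A)%VF (v c).
    rewrite /f /translation /= wE add0r linearN add_lfunE opp_lfunE id_lfunE.
    by rewrite addrAC addrC [- _ + _]addrC.
  move=> c c' /(congr1 (fun g => g 0)); rewrite !f0 => /addrI vE.
  apply/ffunP => i; apply: val_inj; apply/eqP; rewrite -(@eqr_nat R); apply/eqP.
  have szB : size (map (\1 - A)%VF B) == k by rewrite size_map.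
  have /freeP freeBP : free (Tuple szB) by [].
  pose t (i : 'I_k) : R := 2 / ip B`_i B`_i * ((c i)%:R - (c' i)%:R).
  have tP := freeBP t; have BiPhi : B`_i \in Phi by apply: BPhi; apply: mem_nth.
  have /eqP : t i = 0.
    have {}vE : (\1 - A)%VF (v c - v c') = 0.
      by rewrite linearB; apply/eqP; rewrite subr_eq0; apply/eqP.
    apply: tP; rewrite -[RHS]vE -sumrB linear_sum /=; apply: eq_bigr => l _.
    rewrite (nth_map 0) // -linearZ /=; congr (_ _).
    by rewrite /coroot /t mulrBr scalerBl !scalerMnl !mulr_natr.
  have q0 := root_ip_gt0 hPhi BiPhi.
  by rewrite !mulf_eq0 pnatr_eq0 invr_eq0 (gt_eqF q0) /= subr_eq0 => /eqP.
have [K KP] := generators_height; have [Kb wKb] := height_exists w.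
have [fin _] := conjugacy_class_ball ((k * L).*2 * n + lw) KP wKb.
rewrite -sB -[X in (X ^ _)%N]card_ord -[X in (_ ^ X)%N]card_ord -card_ffun.
apply: card_fset_set_ge fin f_inj _ => c.
have vW := v_short c; split.
  exists (translation (v c)), (translation (- v c)).
  by split; [exact: short_in_W vW | exact: translation_inverse |].
apply: short_word_length.
have -> : ((k * L).*2 * n + lw = k * (n * L) + lw + k * (n * L))%N.
  by rewrite -muln2; ring.
apply: short_comp; last exact: short_inverse (translation_inverse _) vW.
by apply: short_comp => //; exists lw.
Qed.

(** Since the multiple [l * f (l * n + l)] absorbs constant factors and affine
changes of the argument, one constant [l] dominating all the constants in the two
bounds serves for each direction. *)
Lemma conjugacy_class_growth :
  growth_equiv (growth (conjugacy_class W w) S) (fun n => n ^ \dim (moved A))%N.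
Proof.
set k := \dim (moved A).
have [K KP] := generators_height; have [Kb wKb] := height_exists w.
split.
  set m := (size Phi ^ size Phi)%N.
  pose l := (m + K.*2 + Kb.*2.+1)%N; exists l => [|n]; first by rewrite /l; lia.
  have [_ le] := conjugacy_class_ball n KP wKb.
  apply: leq_trans le _; apply: leq_trans (leq_addr _ _).
  apply: leq_mul; first by rewrite /l; lia.
  rewrite -/k; case: (k) => // k'; rewrite leq_exp2r // /l; nia.
have [D [D' DP]] := conjugacy_class_lower.
exists (D + D').+1 => // n; apply: leq_trans (DP n) _.
apply: leq_trans (leq_addr _ _); apply: (@leq_trans (growth (conjugacy_class W w) S
  ((D + D').+1 * n + (D + D').+1))); last by rewrite leq_pmull.
have [fin _] := conjugacy_class_ball (D * n + D') KP wKb.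
have [fin' _] := conjugacy_class_ball ((D + D').+1 * n + (D + D').+1) KP wKb.
apply: fsubset_leq_card; rewrite -(fset_set_sub fin fin') => g [Cg gn]; split=> //.
by apply: leq_trans gn _; apply: leq_add; [rewrite leq_mul2r|]; lia.
Qed.

End Growth.

Theorem theorem4p11 (R : realType) (V : vectType R)
    (ip : {dot V for (@idfun R)}%R) (Phi : seq V)
    (hPhi : crystallographic_root_system ip Phi)
    (w t u : V -> V)
    (hw : affine_coxeter_group ip Phi w)
    (hwtu : translation_elliptic_factorisation ip Phi w t u)
    (S : set (V -> V))
    (hS : finite_generating_set (affine_coxeter_group ip Phi) S) :
  growth_equiv
    (growth (conjugacy_class (affine_coxeter_group ip Phi) w) S)
    (fun n : nat => (n ^ reflection_length ip Phi u)%N).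
Proof.
have [[Wt [v tE]] Wu ell wtu] := hwtu.
have [A [b uA]] := coxeter_affine_symmetry hPhi Wu.
have [B [c wB]] := coxeter_affine_symmetry hPhi hw.
rewrite (reflection_length_elliptic hPhi Wu uA ell).
have -> : A = B.
  have [uE _ _ _ _] := uA; have [wE _ _ _ _] := wB; apply/lfunP => x.
  have := wE x; have := wE 0; rewrite wtu tE /= !uE !linear0 !add0r => <-.
  by rewrite -addrA => /addIr.
exact: (conjugacy_class_growth hPhi hS hw wB).
Qed.
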